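(* Let $\mathcal H_1,\mathcal H_2$ be finite-dimensional complex Hilbert spaces, let $\rho_1,\dots,\rho_n$ be density operators on $\mathcal H_1$, $\sigma_1,\dots,\sigma_n$ density operators on $\mathcal H_2$, and $\eta_1,\dots,\eta_n\in[0,1]$. For each $i$ fix a decomposition $\rho_i=\sum_{k=1}^{t_i}|\tilde\varphi^{(i)}_k\rangle\langle\tilde\varphi^{(i)}_k|$ with (non-normalized) vectors $|\tilde\varphi^{(i)}_k\rangle\in\mathcal H_1$. Let $\tilde X$ be the square block matrix of size $\sum_i t_i$ with blocks $(\tilde X_{ij})_{kl}=\langle\tilde\varphi^{(i)}_k|\tilde\varphi^{(j)}_l\rangle$. Then the transformation $\{\rho_1,\dots,\rho_n\}\to\{\sigma_1,\dots,\sigma_n\}$ can be implemented with success probabilities $\{\eta_1,\dots,\eta_n\}$ if and only if there exist a finite-dimensional Hilbert space $\mathcal H_a$ and (non-normalized) vectors $|\tilde\phi^{(i)}_k\rangle\in\mathcal H_2\otimes\mathcal H_a$ ($1\le i\le n$, $1\le k\le t_i$) with $$\sum_{k=1}^{t_i}\mathrm{Tr}_a\big(|\tilde\phi^{(i)}_k\rangle\langle\tilde\phi^{(i)}_k|\big)=\eta_i\sigma_i\quad\text{for all } i,$$ such that $$\tilde X-\tilde Y\ \ge\ 0,$$ where $\tilde Y$ is the block matrix with blocks $(\tilde Y_{ij})_{kl}=\langle\tilde\phi^{(i)}_k|\tilde\phi^{(j)}_l\rangle$. Moreover, if the input states are chosen with prior probabilities $p_1,\dots,p_n\ge 0$, $\sum_i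 p_i=1$, then the whole success probability of such a transformation is $P=\sum_i p_i\eta_i=\sum_i p_i\,\mathrm{Tr}(\tilde Y_{ii})$.
   Context: A physically accessible operation from $\mathcal H_1$ to $\mathcal H_2$ is a completely positive trace non-increasing map $\xi$ from operators on $\mathcal H_1$ to operators on $\mathcal H_2$, i.e. $\xi(\rho)=\sum_m M_m\rho M_m^\dagger$ with $\sum_m M_m^\dagger M_m\le I$. The transformation $\{\rho_i\}\to\{\sigma_i\}$ ''can be implemented with success probabilities $\{\eta_i\}$'' means that there is a single such map $\xi$ with $\xi(\rho_i)=\eta_i\sigma_i$ for all $i$. $\mathrm{Tr}_a$ denotes the partial trace over $\mathcal H_a$. The success probability on an input state $\rho$ is $\mathrm{Tr}\,\xi(\rho)$, and the whole success probability for input states $\rho_i$ with priors $p_i$ is $P=\sum_i p_i\,\mathrm{Tr}\,\xi(\rho_i)$. $M\ge 0$ means $M$ is Hermitian positive semidefinite. *)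

(* Defs.v *)
From mathcomp Require Import all_boot all_order all_algebra.
From mathcomp Require Import reals.
From mathcomp Require Export complex mxtens.

Set Implicit Arguments.
Unset Strict Implicit.
Unset Printing Implicit Defensive.

Import Order.TTheory GRing.Theory Num.Theory.
Local Open Scope ring_scope.
Local Open Scope complex_scope.
Local Open Scope sesquilinear_scope.

(* A finite-dimensional complex Hilbert space is C^d with its standard inner
   product, C := R[i] for R : realType. Vectors are columns, operators are
   matrices acting on the left, and [A ^t*] is the adjoint of A.
   C^d (x) C^a is C^(d * a), with the indexing [mxtens_index] of the Kronecker
   product [*t]. *)

Section Hilbert.
Variable R : realType.
Local Notation C := R[i].

(* <u|v>, antilinear in u *)
Definition braket d (u v : 'cV[C]_d) : C := (u ^t* *m v) 0 0.

(* |u><u| *)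
Definition ketbra d (u : 'cV[C]_d) : 'M[C]_d := u *m u ^t*.

(* In R[i], [0 <= z] says that z is real and nonnegative. *)
Definition psdmx d (A : 'M[C]_d) : Prop :=
  A \is hermsymmx /\ forall v : 'cV[C]_d, 0 <= braket v (A *m v).

Definition density d (rho : 'M[C]_d) : Prop := psdmx rho /\ \tr rho = 1.

Definition ptrace d a (A : 'M[C]_(d * a)) : 'M[C]_d :=
  \matrix_(i, j) \sum_(k < a) A (mxtens_index (i, k)) (mxtens_index (j, k)).

(* Completely positive trace non-increasing maps, in Kraus form. *)
Definition quantum_operation d1 d2 (xi : 'M[C]_d1 -> 'M[C]_d2) : Prop :=
  exists (r : nat) (M : 'I_r -> 'M[C]_(d2, d1)),
    (forall X, xi X = \sum_(m < r) M m *m X *m (M m) ^t*) /\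
    psdmx (1%:M - \sum_(m < r) (M m) ^t* *m M m).

Definition implements d1 d2 n (xi : 'M[C]_d1 -> 'M[C]_d2)
    (rho : 'I_n -> 'M[C]_d1) (sigma : 'I_n -> 'M[C]_d2) (eta : 'I_n -> R) :
    Prop :=
  quantum_operation xi /\ forall i, xi (rho i) = (eta i)%:C *: sigma i.

(* The Gram matrix of a family of vectors phi_k^(i), k < t_i, as a square
   block matrix of size \sum_i t_i. *)
Definition gram d n (t : 'I_n -> nat)
    (phi : forall i : 'I_n, 'I_(t i) -> 'cV[C]_d) : 'M[C]_(\sum_i t i) :=
  \mxblock_(i < n, j < n) \matrix_(k < t i, l < t j) braket (phi i k) (phi j l).

Definition success_prob d1 d2 n (p : 'I_n -> R) (xi : 'M[C]_d1 -> 'M[C]_d2)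
    (rho : 'I_n -> 'M[C]_d1) : C :=
  \sum_i (p i)%:C * \tr (xi (rho i)).

End Hilbert.

(* Main.v *)
(* A Kraus family M_k is the same thing as one operator K = sum_k M_k (x) |k>
   into the space extended by the Kraus index, with xi X = Tr_a (K X K^+), where
   ^+ is the adjoint, and xi is trace non-increasing iff K is a contraction.
   Both Gram matrices are of the form A^+ A, for A the matrix of columns, so the
   claim reduces to Douglas' factorization: B^+ B <= A^+ A iff B = K A for some
   contraction K. *)
Require Import Defs.
From mathcomp Require Import all_boot all_order all_algebra.
From mathcomp Require Import reals.

Set Implicit Arguments.
Unset Strict Implicit.
Unset Printing Implicit Defensive.

Import Order.TTheory GRing.Theory Num.Theory.
Local Open Scope ring_scope.
Local Open Scope complex_scope.
Local Open Scope sesquilinear_scope.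

Section Dilation.
Variable R : realType.
Local Notation C := R[i].

Lemma trmxC_mul m n p (A : 'M[C]_(m, n)) (B : 'M[C]_(n, p)) :
  (A *m B) ^t* = B ^t* *m A ^t*.
Proof. by rewrite trmx_mul map_mxM. Qed.

Lemma trmxC_B m n (A B : 'M[C]_(m, n)) : (A - B) ^t* = A ^t* - B ^t*.
Proof. by rewrite linearB map_mxB. Qed.

Lemma trmxC1 n : (1%:M : 'M[C]_n) ^t* = 1%:M.
Proof. by rewrite trmx1 map_mx1. Qed.

Lemma braket_self d (u : 'cV[C]_d) : braket u u = \sum_i `|u i 0| ^+ 2.
Proof.
rewrite /braket mxE; apply: eq_bigr => i _.
by rewrite !mxE mulrC -normCK.
Qed.

Lemma braket_ge0 d (u : 'cV[C]_d) : 0 <= braket u u.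
Proof. by rewrite braket_self sumr_ge0 // => i _; rewrite exprn_ge0. Qed.

Lemma braket_eq0 d (u : 'cV[C]_d) : braket u u <= 0 -> u = 0.
Proof.
move=> u_le0; have : braket u u == 0 by rewrite eq_le u_le0 braket_ge0.
rewrite braket_self psumr_eq0 => [/allP u0|i _]; last by rewrite exprn_ge0.
apply/matrixP=> i j; rewrite ord1 mxE.
by have := u0 i (mem_index_enum _); rewrite /= expf_eq0 normr_eq0 => /eqP.
Qed.

Lemma braket_mul m n p (A : 'M[C]_(p, m)) (B : 'M[C]_(p, n)) u v :
  braket (A *m u) (B *m v) = braket u (A ^t* *m B *m v).
Proof. by rewrite /braket trmxC_mul !mulmxA. Qed.

Lemma braket_mul_eq0 m n (A : 'M[C]_(m, n)) :
  (forall v, braket (A *m v) (A *m v) <= 0) -> A = 0.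
Proof.
move=> A_le0; apply/matrixP=> i j.
have /matrixP/(_ i 0) := braket_eq0 (A_le0 (delta_mx j 0)).
by rewrite -colE !mxE.
Qed.

Lemma braketBr d (u v w : 'cV[C]_d) :
  braket u (v - w) = braket u v - braket u w.
Proof. by rewrite /braket mulmxBr !mxE. Qed.

(** The quadratic form of the difference at v is |A v|^2 - |B v|^2, and a difference of Gram
    matrices is always Hermitian. *)
Lemma psdmx_subP m n p (A : 'M[C]_(m, p)) (B : 'M[C]_(n, p)) :
  psdmx (A ^t* *m A - B ^t* *m B) <->
  forall v, braket (B *m v) (B *m v) <= braket (A *m v) (A *m v).
Proof.
have braket_diff v : braket v ((A ^t* *m A - B ^t* *m B) *m v)
    = braket (A *m v) (A *m v) - braket (B *m v) (B *m v).
  by rewrite mulmxBl braketBr !braket_mul.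
split=> [[_ psd] v|le_BA]; first by rewrite -subr_ge0 -braket_diff.
split=> [|v]; last by rewrite braket_diff subr_ge0.
by apply/is_hermitianmxP; rewrite scale1r trmxC_B !trmxC_mul !trmxCK.
Qed.

(** For every v, |A Z v|^2 = <Z v | A^+ A Z v> = 0. *)
Lemma gram_kernel m n p (A : 'M[C]_(m, n)) (Z : 'M[C]_(n, p)) :
  A ^t* *m A *m Z = 0 -> A *m Z = 0.
Proof.
move=> AAZ; apply: braket_mul_eq0 => v.
rewrite -mulmxA braket_mul mulmxA AAZ mul0mx.
by rewrite /braket mulmx0 mxE.
Qed.

Lemma contraction_factor m n p (A : 'M[C]_(m, p)) (B : 'M[C]_(n, p)) :
  psdmx (A ^t* *m A - B ^t* *m B) ->
  exists2 K : 'M[C]_(n, m), B = K *m A & psdmx (1%:M - K ^t* *m K).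
Proof.
move=> /psdmx_subP le_BA.
(* A and A^+ A have the same kernel, hence the same row space, so A = D A^+ A for some D. *)
have /submxP[D defA] : (A <= A ^t* *m A)%MS.
  by rewrite submxE; apply/eqP/gram_kernel; rewrite mulmx_coker.
(* P is the orthogonal projector onto the column space of A. *)
pose P := A *m D ^t*.
have PA : P ^t* *m A = A by rewrite /P trmxC_mul trmxCK -mulmxA -defA.
have PP : P ^t* *m P = P by rewrite {2}/P mulmxA PA.
have P_herm : P ^t* = P by rewrite -{1}PP trmxC_mul trmxCK PP.
(* D^+ is a generalized inverse of A, as A D^+ A = P A = A. *)
exists (B *m D ^t*).
  (* B - K A = B (1 - D^+ A). By [le_BA], B vanishes wherever A does, and A (1 - D^+ A) = A - P A =
     0. *)
  apply/eqP; rewrite -subr_eq0 -mulmxA -{1}(mulmx1 B) -mulmxBr.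
  apply/eqP/braket_mul_eq0 => v; rewrite -mulmxA.
  apply: le_trans (le_BA _) _.
  rewrite mulmxA mulmxBr mulmx1 mulmxA -/P -{2}P_herm PA subrr mul0mx.
  by rewrite /braket mulmx0 mxE.
(* Contraction: |B D^+ v| <= |A D^+ v| = |P v| <= |v|, the last step because |v|^2 - |P v|^2 = |(1 -
   P) v|^2. *)
have QQ : (1%:M - P) ^t* *m (1%:M - P) = 1%:M - P.
  by rewrite trmxC_B trmxC1 mulmxBr mulmx1 mulmxBl mul1mx PP P_herm subrr subr0.
rewrite -{1}(mulmx1 1%:M) -{1}(trmxC1 m); apply/psdmx_subP=> v.
rewrite mul1mx -mulmxA; apply: le_trans (le_BA _) _.
rewrite mulmxA -/P -subr_ge0 -[X in braket X X - _]mul1mx.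
have := braket_ge0 ((1%:M - P) *m v).
by rewrite !braket_mul QQ PP mulmxBl braketBr trmxC1 mulmx1.
Qed.

(** The vectors become columns in the block order of [gram], so that the Gram matrix is a plain
    product. *)
Definition frame d n (t : 'I_n -> nat)
    (phi : forall i : 'I_n, 'I_(t i) -> 'cV[C]_d) : 'M[C]_(d, \sum_i t i) :=
  \mxrow_i \matrix_(x, k) phi i k x 0.

Lemma gramE d n (t : 'I_n -> nat)
    (phi : forall i : 'I_n, 'I_(t i) -> 'cV[C]_d) :
  gram phi = (frame phi) ^t* *m frame phi.
Proof.
apply/matrixP=> x y; rewrite /gram /frame !mxE /braket mxE.
by apply: eq_bigr => z _; rewrite !mxE.
Qed.

Lemma eq_frameP d1 d2 n (t : 'I_n -> nat) (K : 'M[C]_(d2, d1))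
    (phi : forall i : 'I_n, 'I_(t i) -> 'cV[C]_d1)
    (psi : forall i : 'I_n, 'I_(t i) -> 'cV[C]_d2) :
  frame psi = K *m frame phi <-> forall i k, psi i k = K *m phi i k.
Proof.
rewrite /frame mul_mxrow; split=> [/eq_mxrowP eqK i k|eqK].
  apply/matrixP=> x y; rewrite ord1; have /matrixP/(_ x k) := eqK i.
  by rewrite !mxE => ->; apply: eq_bigr => z _; rewrite mxE.
apply/eq_mxrowP=> i; apply/matrixP=> x k; rewrite !mxE eqK mxE.
by apply: eq_bigr => z _; rewrite mxE.
Qed.

Definition dilation d1 d2 r (M : 'I_r -> 'M[C]_(d2, d1)) : 'M[C]_(d2 * r, d1) :=
  \matrix_(x, j) M (mxtens_unindex x).2 (mxtens_unindex x).1 j.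

(** The Kraus operators are read off K as the slices at a fixed ancilla index k. *)
Lemma dilation_surj d1 d2 r (K : 'M[C]_(d2 * r, d1)) :
  exists M : 'I_r -> 'M[C]_(d2, d1), K = dilation M.
Proof.
exists (fun k => \matrix_(i, j) K (mxtens_index (i, k)) j).
by apply/matrixP=> x j; rewrite !mxE -surjective_pairing mxtens_unindexK.
Qed.

Lemma dilation_gram d1 d2 r (M : 'I_r -> 'M[C]_(d2, d1)) :
  (dilation M) ^t* *m dilation M = \sum_k (M k) ^t* *m M k.
Proof.
apply/matrixP=> i j; rewrite !mxE summxE.
rewrite (reindex (@mxtens_index d2 r)) /=; last first.
  by exists (@mxtens_unindex d2 r) => x _;
    rewrite (mxtens_indexK, mxtens_unindexK).
under [RHS]eq_bigr do rewrite mxE.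
rewrite exchange_big pair_bigA; apply: eq_bigr => -[x k] _.
by rewrite !mxE mxtens_indexK.
Qed.

Lemma ptrace_dilation d1 d2 r (M : 'I_r -> 'M[C]_(d2, d1)) X :
  ptrace (dilation M *m X *m (dilation M) ^t*) = \sum_k M k *m X *m (M k) ^t*.
Proof.
apply/matrixP=> i j; rewrite !mxE summxE; apply: eq_bigr => k _.
rewrite !mxE; apply: eq_bigr => y _; rewrite !mxE mxtens_indexK /=.
by congr (_ * _); apply: eq_bigr => z _; rewrite !mxE mxtens_indexK.
Qed.

Lemma ptrace_sum d a (I : finType) (F : I -> 'M[C]_(d * a)) :
  ptrace (\sum_i F i) = \sum_i ptrace (F i).
Proof.
apply/matrixP=> i j; rewrite mxE summxE.
under [RHS]eq_bigr do rewrite mxE.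
by rewrite exchange_big; apply: eq_bigr => k _; rewrite summxE.
Qed.

Lemma mxtrace_ptrace d a (A : 'M[C]_(d * a)) : \tr (ptrace A) = \tr A.
Proof.
rewrite /mxtrace [RHS](reindex (@mxtens_index d a)) /=; last first.
  by exists (@mxtens_unindex d a) => x _;
    rewrite (mxtens_indexK, mxtens_unindexK).
under eq_bigr do rewrite mxE.
by rewrite pair_bigA; apply: eq_bigr => -[].
Qed.

Lemma mxtrace_ketbra d (u : 'cV[C]_d) : \tr (ketbra u) = braket u u.
Proof. by rewrite /ketbra mxtrace_mulC /mxtrace big_ord1. Qed.

Lemma ketbra_mul m n (K : 'M[C]_(m, n)) (u : 'cV[C]_n) :
  ketbra (K *m u) = K *m ketbra u *m K ^t*.
Proof. by rewrite /ketbra trmxC_mul !mulmxA. Qed.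

(** Translates, in both directions of the equivalence, between the output of the operation on a
    decomposed state and the reduced states of the dilated vectors. *)
Lemma dilation_ketbra d1 d2 r (M : 'I_r -> 'M[C]_(d2, d1)) m
    (u : 'I_m -> 'cV[C]_d1) :
  \sum_k M k *m (\sum_l ketbra (u l)) *m (M k) ^t*
    = \sum_l ptrace (ketbra (dilation M *m u l)).
Proof.
rewrite -ptrace_dilation mulmx_sumr mulmx_suml ptrace_sum.
by apply: eq_bigr => l _; rewrite ketbra_mul.
Qed.

End Dilation.

Theorem lemma4 (R : realType) (d1 d2 n : nat)
    (rho : 'I_n -> 'M[R[i]]_d1) (sigma : 'I_n -> 'M[R[i]]_d2) (eta : 'I_n -> R)
    (t : 'I_n -> nat)
    (varphi : forall i : 'I_n, 'I_(t i) -> 'cV[R[i]]_d1)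
    (rho_density : forall i, density (rho i))
    (sigma_density : forall i, density (sigma i))
    (eta_itv : forall i, 0 <= eta i <= 1)
    (rho_dec : forall i, rho i = \sum_(k < t i) ketbra (varphi i k)) :
  ((exists xi : 'M[R[i]]_d1 -> 'M[R[i]]_d2, implements xi rho sigma eta)
   <->
   (exists (a : nat) (phi : forall i : 'I_n, 'I_(t i) -> 'cV[R[i]]_(d2 * a)),
      (forall i, \sum_(k < t i) ptrace (ketbra (phi i k))
                 = (eta i)%:C *: sigma i) /\
      psdmx (gram varphi - gram phi)))
  /\
  (forall (p : 'I_n -> R), (forall i, 0 <= p i) -> \sum_i p i = 1 ->
   forall xi : 'M[R[i]]_d1 -> 'M[R[i]]_d2, implements xi rho sigma eta ->
   forall (a : nat) (phi : forall i : 'I_n, 'I_(t i) -> 'cV[R[i]]_(d2 * a)),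
     (forall i, \sum_(k < t i) ptrace (ketbra (phi i k))
                = (eta i)%:C *: sigma i) ->
     psdmx (gram varphi - gram phi) ->
     success_prob p xi rho = (\sum_i p i * eta i)%:C /\
     (\sum_i p i * eta i)%:C
       = \sum_i (p i)%:C * \tr (submxblock (gram phi) i i)).
Proof.
split; first split.
- move=> [xi [[r [M [xiE trM]]] xi_rho]].
  (* The ancilla has one dimension per Kraus operator. *)
  exists r, (fun i k => dilation M *m varphi i k); split=> [i|].
    by rewrite -dilation_ketbra -rho_dec -xiE xi_rho.
  have frameK := (eq_frameP (dilation M) varphi _).2 (fun _ _ => erefl).
  rewrite !gramE frameK; apply/psdmx_subP=> v.
  (* Writing 1 as 1^+ 1 turns the trace condition into |K w| <= |w| for K = [dilation M], used at w
     = [frame varphi *m v]. *)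
  move: trM; rewrite -dilation_gram -{1}(mulmx1 1%:M) -{1}(trmxC1 _ d1).
  by move=> /psdmx_subP/(_ (frame varphi *m v)); rewrite mul1mx mulmxA.
- move=> [a [phi [ptrace_phi]]]; rewrite !gramE.
  case/contraction_factor=> K /eq_frameP.
  (* The contraction K taking each varphi to its phi splits into a Kraus operators, and 1 - K^+ K >=
     0 is their trace condition. *)
  have [M ->] := dilation_surj K; rewrite dilation_gram => phiE trM.
  exists (fun X => \sum_k M k *m X *m (M k) ^t*); split.
    by exists a, M.
  move=> i; rewrite rho_dec dilation_ketbra -ptrace_phi.
  by apply: eq_bigr => k _; rewrite phiE.
move=> p _ _ xi [_ xi_rho] a phi ptrace_phi _.
have tr_eta i : \tr ((eta i)%:C *: sigma i) = (eta i)%:C.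
  by rewrite mxtraceZ (proj2 (sigma_density i)) mulr1.
rewrite rmorph_sum; split; apply: eq_bigr => i _; rewrite rmorphM.
  by rewrite xi_rho tr_eta.
(* Both sides are the sum over k of |phi_k^(i)|^2, since the partial trace preserves the trace. *)
congr (_ * _); rewrite /= -[LHS]tr_eta -ptrace_phi raddf_sum mxblockK.
by apply: eq_bigr => k _; rewrite /= mxtrace_ptrace mxtrace_ketbra mxE.
Qed.
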